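(* Let $m_3(s) = f_0 + g^T s + \frac12 H[s]^2 + \frac16 T[s]^3 + \frac{\sigma}{4}\|s\|_W^4$ for $s\in\mathbb{R}^n$. If $s_*$ is a global minimum of $m_3$ over $\mathbb{R}^n$, then $s_*$ satisfies $$\Big(H + \tfrac12 T[s_*] + \sigma\|s_*\|_W^2 W\Big)s_* = -g$$ and $$H + \frac23 T[s_*] + \sigma\|s_*\|_W^2 W + \frac{\Lambda_W}{3}\|s_*\|_W W \succeq 0 .$$
   Context: Here $f_0\in\mathbb{R}$, $g\in\mathbb{R}^n$, $H\in\mathbb{R}^{n\times n}$ is a symmetric matrix, $T\in\mathbb{R}^{n\times n\times n}$ is a symmetric third-order tensor (entries invariant under permutation of indices), $\sigma>0$, and $W\in\mathbb{R}^{n\times n}$ is symmetric positive definite, with $\|v\|_W=\sqrt{v^TWv}$. Notation: $H[s]^2=s^THs$; $T[s]^3=\sum_{i,j,k}T_{ijk}s_is_js_k$; $T[s]$ is the symmetric matrix with entries $\sum_k T_{ijk}s_k$; $T[u][v]^2=\sum_{i,j,k}T_{ijk}u_iv_jv_k$. The weighted tensor norm is $$\Lambda_W=\max_{u,v\in\mathbb{R}^n\setminus\{0\}}\frac{|T[u][v]^2|}{\|u\|_W\|v\|_W^2}.$$ $A\succeq 0$ means that the symmetric matrix $A$ is positive semidefinite. *)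

(* Defs.v *)
From HB Require Import structures.
From mathcomp Require Import all_boot all_order all_algebra.
From mathcomp Require Import all_classical all_reals all_analysis.
From mathcomp Require Import ring.

Set Implicit Arguments.
Unset Strict Implicit.
Unset Printing Implicit Defensive.

Import Order.TTheory GRing.Theory Num.Theory.
Import numFieldNormedType.Exports.

Local Open Scope classical_set_scope.
Local Open Scope ring_scope.

Section Defs.
Variables (R : realType) (n : nat).
Implicit Types (A W H : 'M[R]_n) (s u v : 'cV[R]_n).

Definition dot u v : R := (u^T *m v) 0 0.

Definition quad A s : R := (s^T *m A *m s) 0 0.

Definition symmetric_mx A : Prop := A^T = A.

Definition posdef A : Prop :=
  symmetric_mx A /\ forall s, s != 0 -> 0 < quad A s.

Definition possemidef A : Prop :=
  symmetric_mx A /\ forall s, 0 <= quad A s.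

Definition wnorm W s : R := Num.sqrt (quad W s).

Definition tensor3 := 'I_n -> 'I_n -> 'I_n -> R.
Implicit Types T : tensor3.

Definition symmetric_tensor3 T : Prop := forall i j k,
  [/\ T i k j = T i j k, T j i k = T i j k, T j k i = T i j k,
      T k i j = T i j k & T k j i = T i j k].

Definition tensor_cube T s : R :=
  \sum_i \sum_j \sum_k T i j k * s i 0 * s j 0 * s k 0.

Definition tensor_mx T s : 'M[R]_n :=
  \matrix_(i, j) \sum_k T i j k * s k 0.

Definition tensor_quad T u v : R :=
  \sum_i \sum_j \sum_k T i j k * u i 0 * v j 0 * v k 0.

Definition tensor_ratios T W : set R :=
  [set r | exists u v, [/\ u != 0, v != 0
     & r = `|tensor_quad T u v| / (wnorm W u * wnorm W v ^+ 2)]].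

(* This supremum is a maximum for n > 0 and W positive definite, see
   [LambdaW_max] below; it is 0 for n = 0, where there is no pair (u, v). *)
Definition LambdaW T W : R := sup (tensor_ratios T W).

Definition m3 (f0 : R) (g : 'cV[R]_n) H T (sigma : R) W s : R :=
  f0 + dot g s + 2^-1 * quad H s + 6^-1 * tensor_cube T s
  + sigma / 4 * wnorm W s ^+ 4.

Definition global_minimum (f : 'cV[R]_n -> R) s : Prop :=
  forall x, f s <= f x.

End Defs.

Section LambdaMax.
Variables (R : realType) (n : nat).
Implicit Types (W : 'M[R]_n) (u v : 'cV[R]_n) (T : tensor3 R n).

Lemma quadE W u : quad W u = \sum_j (\sum_i u i 0 * W i j) * u j 0.
Proof.
rewrite /quad mxE; apply: eq_bigr => j _; rewrite mxE; congr (_ * _).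
by apply: eq_bigr => i _; rewrite mxE.
Qed.

Lemma wnormZ W c u : wnorm W (c *: u) = `|c| * wnorm W u.
Proof.
rewrite /wnorm -sqrtr_sqr -sqrtrM ?sqr_ge0//; congr Num.sqrt.
rewrite !quadE mulr_sumr; apply: eq_bigr => j _; rewrite !mulr_suml mulr_sumr.
by apply: eq_bigr => i _; rewrite !mxE; ring.
Qed.

Lemma wnorm_gt0 W u : posdef W -> u != 0 -> 0 < wnorm W u.
Proof. by move=> [_ W0] u0; rewrite sqrtr_gt0 W0. Qed.

Lemma tensor_quadZ T a b u v :
  tensor_quad T (a *: u) (b *: v) = a * b ^+ 2 * tensor_quad T u v.
Proof.
rewrite /tensor_quad mulr_sumr; apply: eq_bigr => i _.
rewrite mulr_sumr; apply: eq_bigr => j _.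
rewrite mulr_sumr; apply: eq_bigr => k _.
by rewrite !mxE; ring.
Qed.


Lemma continuous_sumr (X : topologicalType) (m : nat) (f : 'I_m -> X -> R) :
  (forall i, continuous (f i)) -> continuous (fun x => \sum_i f i x).
Proof.
move=> fc; apply: continuous_big => //; exact: add_continuous.
Qed.

Lemma LambdaW_max T W : (0 < n)%N -> posdef W ->
  tensor_ratios T W (LambdaW T W) /\ ubound (tensor_ratios T W) (LambdaW T W).
Proof.
move=> n0 Wpd.
pose S : set 'rV[R]_n := [set v : 'rV[R]_n | `|v| = 1].
have S0 (v : 'rV[R]_n) : S v -> v^T != 0.
  move=> Sv; apply/eqP => /(congr1 trmx); rewrite trmxK trmx0 => v0.
  by move: Sv; rewrite /S /= v0 normr0 => /eqP; rewrite eq_sym oner_eq0.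
have Scompact : compact S.
  apply: bounded_closed_compact.
    by exists 1; split => // M M1 v /= ->; exact: ltW.
  rewrite (_ : S = Num.norm @^-1` [set x : R | x = 1]) //.
  apply: preimage_closed; last exact: closed_eq.
  by move=> x _; exact: norm_continuous.
pose f (p : 'rV[R]_n * 'rV[R]_n) : R :=
  `|tensor_quad T p.1^T p.2^T| / (wnorm W p.1^T * wnorm W p.2^T ^+ 2).
have c1 i : continuous (fun p : 'rV[R]_n * 'rV[R]_n => p.1^T i 0).
  rewrite (_ : (fun _ => _) = (fun v : 'rV[R]_n => v 0 i) \o fst); last first.
    by apply/funext => p; rewrite /= mxE.
  by move=> p; apply: continuous_comp; [exact: cvg_fst|exact: coord_continuous].
have c2 i : continuous (fun p : 'rV[R]_n * 'rV[R]_n => p.2^T i 0).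
  rewrite (_ : (fun _ => _) = (fun v : 'rV[R]_n => v 0 i) \o snd); last first.
    by apply/funext => p; rewrite /= mxE.
  by move=> p; apply: continuous_comp; [exact: cvg_snd|exact: coord_continuous].
have cw (h : 'rV[R]_n * 'rV[R]_n -> 'cV[R]_n) :
    (forall i, continuous (fun p => h p i 0)) ->
    continuous (fun p => wnorm W (h p)).
  move=> ch p; apply: (continuous_comp (f := fun p => quad W (h p)));
    last exact: sqrt_continuous.
  rewrite (_ : (fun _ => _) = fun p =>
    \sum_j (\sum_i h p i 0 * W i j) * h p j 0); last first.
    by apply/funext => q; rewrite quadE.
  move: p; apply: continuous_sumr => j p; apply: cvgM; last exact: ch.
  by move: p; apply: continuous_sumr => i p; apply: cvgM; [exact: ch|exact: cvg_cst].
have ct : continuous (fun p : 'rV[R]_n * 'rV[R]_n => tensor_quad T p.1^T p.2^T).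
  do 3 apply: continuous_sumr => ?.
  move=> p; apply: cvgM; last exact: c2.
  apply: cvgM; last exact: c2.
  by apply: cvgM; [exact: cvg_cst|exact: c1].
have fc : {within S `*` S, continuous f}.
  apply: continuous_in_subspaceT => p; rewrite inE => -[S1 S2].
  apply: cvgM; first by apply: cvg_norm; exact: ct.
  apply: cvgV; first by rewrite mulf_neq0 ?expf_neq0 ?gt_eqF ?wnorm_gt0 ?S0.
  apply: cvgM; first exact: (cw (fun p => p.1^T)).
  apply: cvgM; exact: (cw (fun p => p.2^T)).
have Snormal (u : 'cV[R]_n) : u != 0 -> S (`|u^T|^-1 *: u^T).
  move=> u0; rewrite /S /= normrZ normfV normr_id mulVf// normr_eq0.
  by apply: contra_neq u0 => /(congr1 trmx); rewrite trmxK trmx0.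
have e0 : const_mx 1 != 0 :> 'cV[R]_n.
  apply/eqP => /matrixP /(_ (Ordinal n0) 0) /eqP.
  by rewrite !mxE oner_eq0.
have SS0 : S `*` S !=set0.
  by eexists (_, _); split; exact: (Snormal _ e0).
have [[p q] pqS fmax] := compact_EVT_max SS0 (compact_setX Scompact Scompact) fc.
move: pqS; rewrite inE => -[/= Sp Sq].
have ub : ubound (tensor_ratios T W) (f (p, q)).
  move=> _ [u [v [u0 v0 ->]]].
  have := fmax (`|u^T|^-1 *: u^T, `|v^T|^-1 *: v^T).
  rewrite inE => /(_ (conj (Snormal _ u0) (Snormal _ v0))).
  apply: le_trans; rewrite /f /= !linearZ /= !trmxK.
  set a := `|u^T|^-1; set b := `|v^T|^-1.
  have [a0 b0] : 0 < a /\ 0 < b.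
    have pos (w : 'cV[R]_n) : w != 0 -> 0 < `|w^T|^-1.
      move=> w0; rewrite invr_gt0 normr_gt0.
      by apply: contra_neq w0 => /(congr1 trmx); rewrite trmxK trmx0.
    by split; exact: pos.
  rewrite tensor_quadZ !wnormZ !(gtr0_norm a0) !(gtr0_norm b0) normrM.
  rewrite (ger0_norm (mulr_ge0 (ltW a0) (sqr_ge0 b))).
  rewrite le_eqVlt; apply/orP; left; apply/eqP; field.
  by rewrite !gt_eqF ?wnorm_gt0.
have mem : tensor_ratios T W (f (p, q)).
  by exists p^T, q^T; split => //; exact: S0.
have -> // : LambdaW T W = f (p, q).
apply/eqP; rewrite eq_le; apply/andP; split.
  by apply: ge_sup => //; exists (f (p, q)).
by apply: ub_le_sup => //; exists (f (p, q)).
Qed.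

End LambdaMax.

(* Main.v *)
(** Write [G := H + T[s]/2 + sigma |s|^2 W]. In the expansion of [m3 (s + t d)],
    the coefficient of [t] is [(g + G s) . d], which gives the first claim.
    Hence, if [s + d] has the same [W]-norm as [s], the expansion reduces to
      [m3 (s + d) - m3 s =
         (H[d]^2 + T[s][d]^2 + T[d]^3 / 3 + sigma |s|^2 |d|^2) / 2],
    and [T[s][d]^2 + T[d]^3 / 3 = 2/3 T[s][d]^2 + 1/3 T[s + d][d]^2] is at most
    [2/3 T[s][d]^2 + Lambda_W / 3 |s| |d|^2]. If [v] is not [W]-orthogonal to
    [s], some nonzero multiple [d] of [v] reflects [s] to a vector [s + d] of
    the same norm. If [v] is [W]-orthogonal to [s], the ordinary second-order
    condition and [|T[s][v]^2| <= Lambda_W |s| |v|^2] suffice. *)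

Require Import Defs.
From HB Require Import structures.
From mathcomp Require Import all_boot all_order all_algebra.
From mathcomp Require Import all_classical all_reals all_analysis.
From mathcomp Require Import ring lra.

Set Implicit Arguments.
Unset Strict Implicit.
Unset Printing Implicit Defensive.

Import Order.TTheory GRing.Theory Num.Theory.
Local Open Scope ring_scope.

(** * Bilinear forms of matrices and the dot product *)

Section BilinearForm.
Variables (R : realType) (n : nat).
Implicit Types (A B : 'M[R]_n) (u v w : 'cV[R]_n).

Definition bilin A u v : R := (u^T *m A *m v) 0 0.

Lemma quad_bilin A u : quad A u = bilin A u u.
Proof. by []. Qed.

Lemma bilinDl A u v w : bilin A (u + v) w = bilin A u w + bilin A v w.
Proof. by rewrite /bilin linearD /= !mulmxDl mxE. Qed.

Lemma bilinDr A u v w : bilin A u (v + w) = bilin A u v + bilin A u w.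
Proof. by rewrite /bilin mulmxDr mxE. Qed.

Lemma bilinZl A c u v : bilin A (c *: u) v = c * bilin A u v.
Proof. by rewrite /bilin linearZ /= -!scalemxAl mxE. Qed.

Lemma bilinZr A c u v : bilin A u (c *: v) = c * bilin A u v.
Proof. by rewrite /bilin -scalemxAr mxE. Qed.

Lemma bilin_mxD A B u v : bilin (A + B) u v = bilin A u v + bilin B u v.
Proof. by rewrite /bilin mulmxDr mulmxDl mxE. Qed.

Lemma bilin_mxZ A c u v : bilin (c *: A) u v = c * bilin A u v.
Proof. by rewrite /bilin -scalemxAr -scalemxAl mxE. Qed.

Lemma bilin_sym A u v : symmetric_mx A -> bilin A u v = bilin A v u.
Proof.
move=> sA; transitivity ((u^T *m A *m v)^T 0 0); first by rewrite mxE.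
by rewrite !trmx_mul trmxK sA mulmxA.
Qed.

Lemma dot_mulmx A u v : dot (A *m u) v = bilin A^T u v.
Proof. by rewrite /dot /bilin trmx_mul. Qed.

Lemma dotDl u v w : dot (u + v) w = dot u w + dot v w.
Proof. by rewrite /dot linearD /= mulmxDl mxE. Qed.

Lemma dotDr u v w : dot u (v + w) = dot u v + dot u w.
Proof. by rewrite /dot mulmxDr mxE. Qed.

Lemma dotZr c u v : dot u (c *: v) = c * dot u v.
Proof. by rewrite /dot -scalemxAr mxE. Qed.

Lemma dot_self_le0 u : dot u u <= 0 -> u = 0.
Proof.
have -> : dot u u = \sum_i u i 0 ^+ 2.
  by rewrite /dot mxE; apply: eq_bigr => i _; rewrite mxE expr2.
move=> u_le0; apply/matrixP => i j; rewrite ord1 mxE; apply/eqP.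
have ge0 k : true -> 0 <= u k 0 ^+ 2 by rewrite sqr_ge0.
have /eqP : \sum_k u k 0 ^+ 2 = 0.
  by apply/eqP; rewrite eq_le u_le0 sumr_ge0.
by rewrite psumr_eq0// => /allP /(_ i (mem_index_enum _)); rewrite sqrf_eq0.
Qed.

End BilinearForm.

(** * The trilinear form of a symmetric tensor *)

Section TrilinearForm.
Variables (R : realType) (n : nat) (T : tensor3 R n).
Implicit Types (u v w : 'cV[R]_n).

(** Polarised form: [tensor_cube T u] and [tensor_quad T u v] unfold to [trilin u u u] and
    [trilin u v v]. *)
Definition trilin u v w : R :=
  \sum_i \sum_j \sum_k T i j k * u i 0 * v j 0 * w k 0.

Lemma tensor_cube_trilin u : tensor_cube T u = trilin u u u.
Proof. by []. Qed.

Lemma trilinDl u u' v w : trilin (u + u') v w = trilin u v w + trilin u' v w.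
Proof.
rewrite /trilin -big_split; apply: eq_bigr => i _ /=.
rewrite -big_split; apply: eq_bigr => j _ /=.
by rewrite -big_split; apply: eq_bigr => k _ /=; rewrite mxE; ring.
Qed.

Lemma trilinZl c u v w : trilin (c *: u) v w = c * trilin u v w.
Proof.
rewrite /trilin mulr_sumr; apply: eq_bigr => i _.
rewrite mulr_sumr; apply: eq_bigr => j _.
by rewrite mulr_sumr; apply: eq_bigr => k _; rewrite mxE; ring.
Qed.

Hypothesis symT : symmetric_tensor3 T.

Lemma trilinC12 u v w : trilin u v w = trilin v u w.
Proof.
rewrite /trilin exchange_big; apply: eq_bigr => i _; apply: eq_bigr => j _.
by apply: eq_bigr => k _; have [_ -> _ _ _] := symT i j k; ring.
Qed.

Lemma trilinC23 u v w : trilin u v w = trilin u w v.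
Proof.
rewrite /trilin; apply: eq_bigr => i _; rewrite exchange_big.
apply: eq_bigr => j _; apply: eq_bigr => k _.
by have [-> _ _ _ _] := symT i j k; ring.
Qed.

Lemma trilinDm u v v' w : trilin u (v + v') w = trilin u v w + trilin u v' w.
Proof. by rewrite trilinC12 trilinDl !(trilinC12 u). Qed.

Lemma trilinDr u v w w' : trilin u v (w + w') = trilin u v w + trilin u v w'.
Proof. by rewrite trilinC23 trilinDm !(trilinC23 u v). Qed.

Lemma trilinZm c u v w : trilin u (c *: v) w = c * trilin u v w.
Proof. by rewrite trilinC12 trilinZl (trilinC12 u). Qed.

Lemma trilinZr c u v w : trilin u v (c *: w) = c * trilin u v w.
Proof. by rewrite trilinC23 trilinZm (trilinC23 u v). Qed.

Lemma bilin_tensor_mx u v w : bilin (tensor_mx T u) v w = trilin u v w.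
Proof.
(* [tensor_mx] contracts the third index, so symmetry first moves [u] to the third slot. *)
rewrite trilinC12 trilinC23 /bilin /trilin mxE.
under eq_bigr => j _ do rewrite mxE mulr_suml.
rewrite exchange_big; apply: eq_bigr => i _; apply: eq_bigr => j _.
rewrite !mxE mulr_sumr mulr_suml; apply: eq_bigr => k _.
by ring.
Qed.

Lemma tensor_mx_sym u : symmetric_mx (tensor_mx T u).
Proof.
apply/matrixP => i j; rewrite !mxE; apply: eq_bigr => k _.
by have [_ -> _ _ _] := symT i j k.
Qed.

End TrilinearForm.

(** * The weighted norm and the tensor norm inequality *)

Section WeightedNorm.
Variables (R : realType) (n : nat) (W : 'M[R]_n).
Hypothesis hW : posdef W.
Implicit Types (u v : 'cV[R]_n).

Lemma posdef_quad_ge0 u : 0 <= quad W u.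
Proof.
have [->|u0] := eqVneq u 0; first by rewrite /quad mulmx0 mxE.
by have [_ W0] := hW; exact/ltW/W0.
Qed.

Lemma sqr_wnorm u : wnorm W u ^+ 2 = quad W u.
Proof. by rewrite /wnorm sqr_sqrtr// posdef_quad_ge0. Qed.

(** Zero vectors lie outside [tensor_ratios], but both sides are then 0; otherwise the upper bound
    of [LambdaW_max] is multiplied by its denominator. *)
Lemma tensor_quad_le (T : tensor3 R n) u v :
  `|tensor_quad T u v| <= LambdaW T W * wnorm W u * wnorm W v ^+ 2.
Proof.
have wnorm0 : wnorm W 0 = 0.
  by rewrite -(scale0r (0 : 'cV_n)) wnormZ normr0 mul0r.
have [->|u0] := eqVneq u 0.
  have -> : tensor_quad T 0 v = 0.
    by rewrite -(scale0r (0 : 'cV_n)) -[v]scale1r tensor_quadZ !mul0r.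
  by rewrite normr0 wnorm0 mulr0 mul0r.
have [->|v0] := eqVneq v 0.
  have -> : tensor_quad T u 0 = 0.
    rewrite -(scale0r (0 : 'cV_n)) -[u]scale1r tensor_quadZ.
    by rewrite expr0n /= mulr0 mul0r.
  by rewrite normr0 wnorm0 expr0n /= mulr0.
(* A nonzero [u] exists only in positive dimension. *)
have n0 : (0 < n)%N.
  case: (posnP n) => // n0; case/eqP: u0; apply/matrixP => i.
  by have : (i < 0)%N by rewrite -n0 ltn_ord.
have [_ ub] := @LambdaW_max R n T W n0 hW.
have := ub _ (ex_intro _ u (ex_intro _ v (And3 u0 v0 erefl))).
by rewrite ler_pdivrMr ?mulr_gt0 ?exprn_gt0 ?wnorm_gt0// mulrA.
Qed.

End WeightedNorm.

(** Stands in for the limit as [t] tends to 0: it extracts the first- and second-order conditions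
    from increments along a line, once a power of [t] is divided out. *)
Lemma cubic_ge0_const_ge0 (R : realFieldType) (a b c d : R) :
  (forall t, 0 < t -> 0 <= a + b * t + c * t ^+ 2 + d * t ^+ 3) -> 0 <= a.
Proof.
move=> ge0; rewrite leNgt; apply/negP => a0.
pose M := `|b| + `|c| + `|d|.
have M0 : 0 <= M by rewrite !addr_ge0.
have Ma : 0 < M - a by lra.
(* [t <= 1], so the cubic is at most [a + M t = - a^2 / (M - a)]. *)
pose t := - a / (M - a).
have t0 : 0 < t by rewrite divr_gt0// oppr_gt0.
have t1 : t <= 1 by rewrite ler_pdivrMr//; lra.
have le_abs x k : x * t ^+ k.+1 <= `|x| * t.
  apply: (@le_trans _ _ (`|x| * t ^+ k.+1)).
    by rewrite ler_wpM2r ?ler_norm// exprn_ge0// ltW.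
  by rewrite ler_wpM2l// exprS ler_piMr ?exprn_ile1// ltW.
have := ge0 _ t0; apply/negP; rewrite -ltNge.
have aM : a + M * t = - (a ^+ 2 / (M - a)).
  by rewrite /t; field; rewrite gt_eqF.
have : 0 < a ^+ 2 / (M - a).
  by rewrite divr_gt0// exprn_even_gt0//= lt_eqF.
have := le_abs b 0%N; have := le_abs c 1%N; have := le_abs d 2%N.
rewrite expr1; move: aM; rewrite /M !mulrDl => aM.
move: (`|b| * t) (`|c| * t) (`|d| * t) (a ^+ 2 / _) aM => *; lra.
Qed.

(** * Exact expansion of [m3] and optimality conditions *)

Section Expansion.
Variables (R : realType) (n : nat) (f0 : R) (g : 'cV[R]_n) (H : 'M[R]_n).
Variables (T : tensor3 R n) (sigma : R) (W : 'M[R]_n).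
Hypotheses (hH : symmetric_mx H) (hT : symmetric_tensor3 T) (hW : posdef W).
Implicit Types (s d : 'cV[R]_n).

(** The cubic term [T[s]^3 / 6] has gradient [T[s] s / 2], and the quartic term has gradient
    [sigma |s|^2 W s]. *)
Definition gradient_m3 s : 'cV[R]_n :=
  g + (H + 2^-1 *: tensor_mx T s + (sigma * wnorm W s ^+ 2) *: W) *m s.

Lemma dot_gradient_m3 s d : dot (gradient_m3 s) d =
  dot g d + bilin H s d + 2^-1 * trilin T s s d + sigma * quad W s * bilin W s d.
Proof.
have [sW _] := hW.
rewrite /gradient_m3 dotDl dot_mulmx !linearD !linearZ /= hH sW tensor_mx_sym//.
by rewrite !bilin_mxD !bilin_mxZ bilin_tensor_mx// sqr_wnorm// !addrA.
Qed.

(** The quartic part stays a difference of squares, so that it vanishes when [s] and [s + d] have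
    equal norm; the last term removes its linear part, already counted in the gradient. *)
Lemma m3_expand s d :
  m3 f0 g H T sigma W (s + d) = m3 f0 g H T sigma W s + dot (gradient_m3 s) d
    + 2^-1 * quad H d + 2^-1 * trilin T s d d + 6^-1 * trilin T d d d
    + sigma / 4 * ((quad W (s + d)) ^+ 2 - (quad W s) ^+ 2)
    - sigma * quad W s * bilin W s d.
Proof.
have w4 u : wnorm W u ^+ 4 = quad W u ^+ 2.
  by rewrite (exprM _ 2 2) sqr_wnorm.
rewrite /m3 dot_gradient_m3 !w4 dotDr !tensor_cube_trilin.
rewrite !(quad_bilin H) bilinDl !bilinDr (bilin_sym d s hH).
rewrite !trilinDl !trilinDm// !trilinDr//.
(* Symmetry brings all mixed terms to [trilin T s s d] and [trilin T s d d]. *)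
rewrite (trilinC12 hT d s s) (trilinC23 hT s d s) (trilinC12 hT d s d).
rewrite (trilinC23 hT d d s) (trilinC12 hT d s d).
by field.
Qed.

Lemma quadD_posdef s d :
  quad W (s + d) = quad W s + 2 * bilin W s d + quad W d.
Proof.
have [sW _] := hW.
by rewrite !quad_bilin bilinDl !bilinDr (bilin_sym d s sW); ring.
Qed.

Lemma m3_expand_line s d t :
  m3 f0 g H T sigma W (s + t *: d) = m3 f0 g H T sigma W s
    + t * (dot (gradient_m3 s) d
      + (2^-1 * (quad H d + trilin T s d d + sigma * quad W s * quad W d)
          + sigma * bilin W s d ^+ 2) * t
      + (6^-1 * trilin T d d d + sigma * bilin W s d * quad W d) * t ^+ 2
      + sigma / 4 * quad W d ^+ 2 * t ^+ 3).
Proof.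
rewrite m3_expand quadD_posdef dotZr !quad_bilin.
by rewrite !(bilinZl, bilinZr, trilinZl, trilinZm hT, trilinZr hT); field.
Qed.

Variable s : 'cV[R]_n.
Hypothesis hs : global_minimum (m3 f0 g H T sigma W) s.

Lemma global_minimum_gradient0 : gradient_m3 s = 0.
Proof.
(* The direction tested is minus the gradient, whose slope is minus the squared Euclidean norm of
   the gradient. *)
apply: dot_self_le0; rewrite -oppr_ge0 -mulN1r -dotZr.
apply: cubic_ge0_const_ge0 => t t0.
have := hs (s + t *: (-1 *: gradient_m3 s)).
by rewrite m3_expand_line lerDl pmulr_rge0//; exact.
Qed.

Lemma dot_gradient0 d : dot (gradient_m3 s) d = 0.
Proof. by rewrite global_minimum_gradient0 /dot trmx0 mul0mx mxE. Qed.

(** The right-hand side is half the Hessian form of [m3] at [s]. With the gradient zero, a second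
    factor [t] divides out of the increment and this becomes the constant term. *)
Lemma global_minimum_second_order d :
  0 <= 2^-1 * (quad H d + trilin T s d d + sigma * quad W s * quad W d)
       + sigma * bilin W s d ^+ 2.
Proof.
apply: (@cubic_ge0_const_ge0 _ _
  (6^-1 * trilin T d d d + sigma * bilin W s d * quad W d)
  (sigma / 4 * quad W d ^+ 2) 0) => t t0.
have := hs (s + t *: d).
rewrite m3_expand_line lerDl dot_gradient0 pmulr_rge0// => ge0.
by rewrite -(pmulr_rge0 _ t0); move: ge0; congr (_ <= _); ring.
Qed.

Lemma global_minimum_same_norm d : quad W (s + d) = quad W s ->
  0 <= quad H d + trilin T s d d + 3^-1 * trilin T d d d
       + sigma * quad W s * quad W d.
Proof.
move=> eqW; have := hs (s + d); rewrite m3_expand eqW dot_gradient0.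
(* Equal norms fix the inner product of [s] and [d], which turns the remaining linear term into the
   [sigma |s|^2 |d|^2] contribution. *)
have -> : bilin W s d = - (2^-1 * quad W d).
  by move: eqW; rewrite quadD_posdef => eqW; lra.
by rewrite -subr_ge0; set x := sigma * _; set y := quad W d; nra.
Qed.

Lemma global_minimum_possemidef :
  possemidef (H + (2 / 3) *: tensor_mx T s + (sigma * wnorm W s ^+ 2) *: W
              + (LambdaW T W / 3 * wnorm W s) *: W).
Proof.
have [sW Wpos] := hW; split.
  by rewrite /symmetric_mx !linearD !linearZ /= hH sW tensor_mx_sym.
move=> v; set A := (X in quad X _).
have AE d : quad A d = quad H d + 2 / 3 * trilin T s d d
    + sigma * quad W s * quad W d + LambdaW T W / 3 * wnorm W s * quad W d.
  rewrite /A quad_bilin !bilin_mxD !bilin_mxZ bilin_tensor_mx//.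
  by rewrite sqr_wnorm.
have le_Lambda u d : trilin T u d d <= LambdaW T W * wnorm W u * quad W d.
  rewrite -sqr_wnorm//; apply: le_trans (tensor_quad_le hW T u d).
  exact: ler_norm.
(* In the orthogonal case [quad A v] exceeds the Hessian form by a third of [Lambda_W |s| |v|^2 -
   T[s][v]^2], which is nonnegative. *)
have [b0|b0] := eqVneq (bilin W s v) 0.
  have := global_minimum_second_order v; rewrite b0 AE.
  by have := le_Lambda s v; nra.
have v0 : v != 0.
  by apply: contraNneq b0 => ->; rewrite /bilin mulmx0 mxE.
have qv0 := Wpos v v0.
(* [c] is the nonzero root of [2 c bilin W s v + c^2 quad W v = 0], the condition that [s + c v] has
   the norm of [s]. *)
pose c := - 2 * bilin W s v / quad W v; pose d := c *: v.
have c0 : c != 0.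
  by rewrite !mulf_neq0 ?invr_eq0 ?(gt_eqF qv0) ?oppr_eq0 ?pnatr_eq0.
have eqW : quad W (s + d) = quad W s.
  rewrite quadD_posdef (quad_bilin _ d) bilinZl !bilinZr -quad_bilin /c.
  by field; rewrite gt_eqF.
have : 0 <= quad A d.
  have := global_minimum_same_norm eqW; rewrite AE.
  (* The bound is taken at [s + d] because its norm is that of [s]. *)
  have := le_Lambda (s + d) d; rewrite trilinDl /wnorm eqW -/(wnorm W s).
  by nra.
(* [quad A d] is [c^2] times [quad A v], so the sign passes from [d] to [v]. *)
rewrite !quad_bilin bilinZl bilinZr mulrA pmulr_rge0//.
by rewrite -expr2 exprn_even_gt0.
Qed.

End Expansion.

Unset Implicit Arguments.

Theorem theorem2p1 (R : realType) (n : nat) (f0 : R) (g : 'cV[R]_n)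
    (H : 'M[R]_n) (T : tensor3 R n) (sigma : R) (W : 'M[R]_n)
    (hH : symmetric_mx H) (hT : symmetric_tensor3 T)
    (hsigma : 0 < sigma) (hW : posdef W)
    (s : 'cV[R]_n) (hs : global_minimum (m3 f0 g H T sigma W) s) :
  (H + 2^-1 *: tensor_mx T s + (sigma * wnorm W s ^+ 2) *: W) *m s = - g
  /\ possemidef (H + (2 / 3) *: tensor_mx T s
                 + (sigma * wnorm W s ^+ 2) *: W
                 + (LambdaW T W / 3 * wnorm W s) *: W).
Proof.
split; last exact: global_minimum_possemidef hs.
apply/eqP; rewrite -addr_eq0 addrC; apply/eqP.
exact: global_minimum_gradient0 hs.
Qed.
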